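(* (Discrete orthogonality for Krein–Adler polynomials.) Consider one of the Hermite (H), Laguerre (L) or Jacobi (J) cases. Let $\mathcal D=\{d_1<\dots<d_M\}$ be a set of positive integers satisfying the Krein–Adler condition $\prod_{j=1}^M(m-d_j)\ge0$ for all integers $m\ge0$, let $\mathcal N\ge1$ be an integer with $\mathcal N\notin\mathcal D$, put $\widetilde{\mathcal N}=\ell'_{\mathcal D}+\mathcal N$ and let $\eta_1,\dots,\eta_{\widetilde{\mathcal N}}\in\mathbb C$ be the zeros of $P_{\mathcal D,\mathcal N}(\eta)$. Write $\dot\eta_l^{2}=1$ (H), $4\eta_l$ (L), $4(1-\eta_l^2)$ (J). Then $$\sum_{l=1}^{\widetilde{\mathcal N}}\frac{P_{\mathcal D,n}(\eta_l)P_{\mathcal D,m}(\eta_l)}{\dot\eta_l^{2}\bigl(P'_{\mathcal D,\mathcal N}(\eta_l)\bigr)^2}=0\qquad(m\ne n,\ m,n\in\{0,1,\dots,\mathcal N-1\}\setminus\mathcal D),$$ $$\sum_{l=1}^{\widetilde{\mathcal N}}\frac{P_{\mathcal D,m}(\eta_l)P_{\mathcal D',\mathcal N}(\eta_l)}{\dot\eta_l^{2}\bigl(P'_{\mathcal D,\mathcal N}(\eta_l)\bigr)^2}=0\qquad(m\in\{0,1,\dots,\mathcal N-1\}\setminus\mathcal D,\ \mathcal D'\in\mathcal{EP}),$$ $$\sum_{l=1}^{\widetilde{\mathcal N}}\frac{P_{\mathcal D',\mathcal N}(\eta_l)P_{\mathcal D'',\mathcal N}(\eta_l)}{\dot\eta_l^{2}\bigl(P'_{\mathcal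 D,\mathcal N}(\eta_l)\bigr)^2}=0\qquad(\mathcal D'\ne\mathcal D'',\ \mathcal D',\mathcal D''\in\mathcal{EP}).$$
   Context: Base polynomials: $P_n=H_n$ (Hermite, H); $P_n=L_n^{(g-1/2)}$ (Laguerre, L, real $g>\frac12$); $P_n=P_n^{(g-1/2,h-1/2)}$ (Jacobi, J, real $g,h>\frac12$). ${\rm W}[f_1,\dots,f_r](\eta)=\det(d^{i-1}f_j/d\eta^{i-1})_{1\le i,j\le r}$. For a list $\mathcal A=(a_1,\dots,a_M)$ of distinct non-negative integers the Krein–Adler polynomial is $P_{\mathcal A,n}(\eta)={\rm W}[P_{a_1},\dots,P_{a_M},P_n](\eta)$. $\mathcal D$ is identified with $(d_1,\dots,d_M)$, and $\ell'_{\mathcal D}=\sum_{j=1}^M d_j-\frac12M(M+1)$. $\mathcal{EP}$ is the set of lists $\mathcal D'=(d_1,\dots,d_{j-1},\epsilon,d_{j+1},\dots,d_M)$ obtained from $\mathcal D$ by replacing one $d_j$ by an integer $\epsilon$ with $0\le\epsilon<d_j$, $\epsilon\notin\mathcal D$, $\epsilon\ne\mathcal N$. $P'_{\mathcal D,\mathcal N}$ is the derivative in $\eta$. Standing assumption: $P_{\mathcal D,\mathcal N}$ has degree exactly $\widetilde{\mathcal N}$, its $\widetilde{\mathcal N}$ zeros are pairwise distinct, and none of them equals $0$ (case L) or $\pm1$ (case J). *)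

(* Defs.v *)
From mathcomp Require Export all_boot all_order all_algebra.
From mathcomp Require Export reals.
From mathcomp Require Export complex.
Set Implicit Arguments.
Unset Strict Implicit.
Unset Printing Implicit Defensive.
Import Order.TTheory GRing.Theory Num.Theory.
Local Open Scope ring_scope.

(* Pochhammer symbol (a)_k = a (a + 1) ... (a + k - 1) *)
Definition pochhammer (F : fieldType) (a : F) (k : nat) : F :=
  \prod_(i < k) (a + i%:R).

(* H_n(x) = n! sum_k (-1)^k (2 x)^(n - 2 k) / (k! (n - 2 k)!)  (physicists'
   normalization) *)
Definition hermite (F : fieldType) (n : nat) : {poly F} :=
  \sum_(k < (n./2).+1)
     ((-1) ^+ k * n`!%:R / (k`!%:R * (n - k.*2)`!%:R))
       *: (2%:R *: 'X) ^+ (n - k.*2).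

(* L_n^(a)(x) = sum_k (a + k + 1)_(n - k) (- x)^k / (k! (n - k)!) *)
Definition laguerre (F : fieldType) (a : F) (n : nat) : {poly F} :=
  \sum_(k < n.+1)
     (pochhammer (a + k%:R + 1) (n - k) / (k`!%:R * (n - k)`!%:R))
       *: (- 'X) ^+ k.

(* P_n^(a,b)(x) = sum_k (n + a + b + 1)_k (a + k + 1)_(n - k)
                          / (k! (n - k)!) ((x - 1) / 2)^k,
   which is (a + 1)_n / n! 2F1(-n, n + a + b + 1; a + 1; (1 - x) / 2) with the
   denominators (a + 1)_k cancelled. *)
Definition jacobi (F : fieldType) (a b : F) (n : nat) : {poly F} :=
  \sum_(k < n.+1)
     (pochhammer (n%:R + a + b + 1) k * pochhammer (a + k%:R + 1) (n - k)
        / (k`!%:R * (n - k)`!%:R))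
       *: (2%:R^-1 *: ('X - 1)) ^+ k.

Inductive family (R : realType) : Type :=
| CaseH
| CaseL of R
| CaseJ of R & R.
Arguments CaseH {R}.

Definition admissible (R : realType) (c : family R) : Prop :=
  match c with
  | CaseH => True
  | CaseL g => 2%:R^-1 < g
  | CaseJ g h => 2%:R^-1 < g /\ 2%:R^-1 < h
  end.

Definition real_base_poly (R : realType) (c : family R) (n : nat) : {poly R} :=
  match c with
  | CaseH => hermite R n
  | CaseL g => laguerre (g - 2%:R^-1) n
  | CaseJ g h => jacobi (g - 2%:R^-1) (h - 2%:R^-1) n
  end.

(* The base polynomials have real coefficients; they are viewed over R[i]
   because their Wronskians are evaluated at complex points. *)
Definition base_poly (R : realType) (c : family R) (n : nat) : {poly R[i]} :=
  map_poly (real_complex R) (real_base_poly c n).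

Definition wronskian (F : fieldType) (fs : seq {poly F}) : {poly F} :=
  \det (\matrix_(i < size fs, j < size fs) (nth 0 fs j)^`(i)).

Definition krein_adler_poly (R : realType) (c : family R) (A : seq nat)
    (n : nat) : {poly R[i]} :=
  wronskian (rcons (map (base_poly c) A) (base_poly c n)).

(* A finite set of positive integers, listed in increasing order. *)
Definition increasing_positive (D : seq nat) : Prop :=
  sorted ltn D /\ (forall d, d \in D -> (0 < d)%N).

Definition krein_adler_condition (D : seq nat) : Prop :=
  forall m : nat, 0 <= \prod_(d <- D) (m%:Z - d%:Z).

(* l'_D = sum_j d_j - M (M + 1) / 2. The subtraction in nat is never truncated
   when increasing_positive D, since then d_j >= j. *)
Definition ell' (D : seq nat) : nat :=
  (\sum_(d <- D) d - (size D * (size D).+1)./2)%N.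

Definition EP (D : seq nat) (N : nat) (D' : seq nat) : Prop :=
  exists (j e : nat),
    [/\ (j < size D)%N, (e < nth 0%N D j)%N, e \notin D, e != N
      & D' = set_nth 0%N D j e].

(* The square of d eta / d x for the change of variable eta(x) = x, x^2,
   cos (2 x), written in terms of eta. *)
Definition eta_dot_sq (R : realType) (c : family R) (z : R[i]) : R[i] :=
  match c with
  | CaseH => 1
  | CaseL _ => 4%:R * z
  | CaseJ _ _ => 4%:R * (1 - z ^+ 2)
  end.

Definition not_endpoint (R : realType) (c : family R) (z : R[i]) : Prop :=
  match c with
  | CaseH => True
  | CaseL _ => z <> 0
  | CaseJ _ _ => z <> 1 /\ z <> -1
  end.

(* Main.v *)
(** Replacing an element [d] of the index set [A = D ++ [N]] by [e] turns the
    Wronskian [t = W(P_A)] into [Q_de], and [F_de = Q_de / t] factors after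
    differentiation: [F_de' = psi_d phi_e], where [psi_d] and [phi_e] are
    eigenfunctions, for the eigenvalues of [P_d] and [P_e], of one and the same
    second order operator [s D^2 + ...] whose potential has a double pole at each
    zero of [t]. Comparing the local expansions at such a zero [z], the residue of
    [F_de dF_d'e' - F_d'e' dF_de] is
    [(E_d + E_e - E_d' - E_e') Q_de(z) Q_d'e'(z) / (s(z) t'(z)^2)]. This form is
    rational without further poles and decays at infinity, so the residues add up
    to zero. At the zeros of [t] the product [Q_de Q_d'e'] equals
    [Q_de' Q_d'e], so that the same sum is also annihilated by
    [E_d + E_e' - E_d' - E_e]. Both factors vanish only if [(d, e) = (d', e')]. *)

Require Import Defs.
From mathcomp Require Import perm.
From mathcomp Require Import ring zify.
Set Implicit Arguments.
Unset Strict Implicit.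
Unset Printing Implicit Defensive.
Import Order.TTheory GRing.Theory Num.Theory.
Local Open Scope ring_scope.

(** * The differential equations of the base polynomials *)

(** Each base polynomial is a sum of powers whose [k]-th term is sent by the differential operator
    to two adjacent powers. [u k] and [- v k] are these contributions, and [u k.+1 = v k] is the
    recurrence of the coefficients. *)
Lemma sum_shifted_cancel (V : zmodType) n (u v : nat -> V) :
  u 0%N = 0 -> v n = 0 -> (forall k, (k < n)%N -> u k.+1 = v k) ->
  \sum_(k < n.+1) (u k - v k) = 0.
Proof.
move=> u0 vn uv; rewrite sumrB big_ord_recl [X in _ - X]big_ord_recr /=.
rewrite u0 vn add0r addr0 -sumrB big1 // => k _.
by rewrite /bump leq0n add1n uv ?subrr.
Qed.

Lemma pochhammerSl (F : fieldType) (a : F) k :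
  pochhammer a k.+1 = a * pochhammer (a + 1) k.
Proof.
rewrite /pochhammer big_ord_recl addr0; congr (_ * _).
by apply: eq_bigr => i _; rewrite lift0 -natr1; ring.
Qed.

Lemma pochhammerSr (F : fieldType) (a : F) k :
  pochhammer a k.+1 = pochhammer a k * (a + k%:R).
Proof. by rewrite /pochhammer big_ord_recr. Qed.

Lemma fact_natr_neq0 (F : numFieldType) k : (k`!%:R : F) != 0.
Proof. by rewrite pnatr_eq0 -lt0n fact_gt0. Qed.

Section ODE.
Variable F : numFieldType.
Implicit Types (a b : F) (n : nat).

Lemma size_linear_exp (u v : F) k : (size ((u *: 'X + v%:P)%R ^+ k)%R <= k.+1)%N.
Proof.
have s2 : (size (u *: 'X + v%:P)%R <= 2)%N.
  rewrite (leq_trans (size_polyD _ _))// geq_max (leq_trans (size_scale_leq _ _)) ?size_polyX //=.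
  by rewrite (leq_trans (size_polyC_leq1 _)).
apply: leq_trans (size_poly_exp_leq _ _) _; rewrite ltnS.
by case: (size _) s2 => [|[|[|m]]] //= _; rewrite ?mul0n ?mul1n.
Qed.

Lemma size_hermite n : (size (hermite F n) <= n.+1)%N.
Proof.
apply: leq_trans (size_sum _ _ _) _; apply/bigmax_leqP => k _.
apply: leq_trans (size_scale_leq _ _) _.
have := size_linear_exp 2%:R 0 (n - k.*2); rewrite addr0 => /leq_trans; apply.
by rewrite ltnS leq_subr.
Qed.

Lemma size_laguerre a n : (size (laguerre a n) <= n.+1)%N.
Proof.
apply: leq_trans (size_sum _ _ _) _; apply/bigmax_leqP => k _.
apply: leq_trans (size_scale_leq _ _) _.
have := size_linear_exp (-1) 0 k; rewrite addr0 scaleN1r => /leq_trans; apply.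
exact: ltn_ord.
Qed.

Lemma size_jacobi a b n : (size (jacobi a b n) <= n.+1)%N.
Proof.
apply: leq_trans (size_sum _ _ _) _; apply/bigmax_leqP => k _.
apply: leq_trans (size_scale_leq _ _) _.
have := size_linear_exp 2%:R^-1 (- 2%:R^-1) k.
have -> : 2%:R^-1 *: 'X + (- 2%:R^-1)%:P = 2%:R^-1 *: ('X - 1) :> {poly F}.
  by rewrite scalerBr polyCN alg_polyC.
by move=> /leq_trans; apply; exact: ltn_ord.
Qed.

Lemma deriv_exp_linear (y : {poly F}) (d : F) k : y^`() = d%:P ->
  (y ^+ k)^`() = (k%:R * d) *: y ^+ k.-1.
Proof. by move=> dy; rewrite deriv_exp dy mul_polyC scalerMnl mulr_natl. Qed.

Lemma hermite_ode n :
  (hermite F n)^`()^`() - 2%:R *: 'X * (hermite F n)^`() =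
  - ((2 * n)%:R *: hermite F n).
Proof.
pose y : {poly F} := 2%:R *: 'X; rewrite -/y.
have dy : y^`() = 2%:R%:P by rewrite derivZ derivX alg_polyC.
pose c k : F := (-1) ^+ k * n`!%:R / (k`!%:R * (n - k.*2)`!%:R).
have -> : hermite F n = \sum_(k < (n./2).+1) c k *: y ^+ (n - k.*2) by [].
apply/eqP; rewrite -subr_eq0 opprK; apply/eqP.
(* With [m = n - k.*2], [u k] collects the terms in [y ^+ m], where 2n - 2m = 4k, and [- v k] is the
   second derivative, of exponent [m.-2]. *)
pose u k : {poly F} := (4 * k)%:R *: (c k *: y ^+ (n - k.*2)).
pose v k : {poly F} := - ((c k * (4 * (n - k.*2) * (n - k.*2).-1)%:R) *: y ^+ (n - k.*2).-2).
transitivity (\sum_(k < (n./2).+1) (u k - v k)).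
  rewrite !raddf_sum /= ?mulr_sumr ?scaler_sumr -sumrB -big_split /=.
  apply: eq_bigr => k _.
  have k2n : (k.*2 <= n)%N.
    by have := ltn_ord k; lia.
  rewrite /u /v; set m := (n - k.*2)%N.
  have -> : (2 * n = 2 * (m + k.*2))%N by rewrite subnK.
  move: (c k) (nat_of_ord k) => ck j.
  rewrite !(derivZ, deriv_exp_linear _ dy) !scalerA.
  rewrite -!mul_polyC !natrM !polyCM !polyC_natr natrD -mul2n natrM.
  by case: m => [|[|m]] /=; rewrite ?expr0 ?expr1 ?exprS; ring.
apply: sum_shifted_cancel.
- by rewrite /u muln0 scale0r.
- rewrite /v.
  (* The last exponent m is 0 or 1, so the factor m(m - 1) in [v] vanishes. *)
  have -> : ((n - n./2.*2)%N = odd n)%N by rewrite -{1}(odd_double_half n) addnK.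
  by case: (odd n); rewrite ?muln0 ?mulr0 ?scale0r ?oppr0.
move=> k kn.
have : (k.+1.*2 <= n)%N by lia.
rewrite doubleS => k2n; rewrite /u /v doubleS.
have -> : (n - k.*2.+2)%N = (n - k.*2).-2 by lia.
case E : (n - k.*2)%N => [|[|m]]; first by lia.
  by lia.
rewrite scalerA -scaleNr; congr (_ *: _).
rewrite /c doubleS E.
have -> : (n - k.*2.+2)%N = m by lia.
rewrite !factS !natrM exprS succnK.
field.
by rewrite !fact_natr_neq0 ?nat1r ?natr1 -?natrD !pnatr_eq0.
Qed.

Lemma laguerre_ode a n :
  'X * (laguerre a n)^`()^`() + ((a + 1)%:P - 'X) * (laguerre a n)^`() =
  - (n%:R *: laguerre a n).
Proof.
pose y : {poly F} := - 'X.
pose c k : F := pochhammer (a + k%:R + 1) (n - k) / (k`!%:R * (n - k)`!%:R).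
have -> : laguerre a n = \sum_(k < n.+1) c k *: y ^+ k by [].
have dy : y^`() = (-1)%:P by rewrite derivN derivX polyCN.
have -> : 'X = - y by rewrite opprK.
have cS k : (k < n)%N ->
    k.+1%:R * (k.+1%:R + a) * c k.+1 = (n%:R - k%:R) * c k.
  move=> kn; rewrite /c -(subnK kn) addnK addnS subSn ?leq_addl // addnK.
  rewrite !factS pochhammerSl.
  have -> : a + k.+1%:R + 1 = a + k%:R + 1 + 1 by rewrite -natr1; ring.
  rewrite -addSn !natrM !natrD -!natr1; field.
  by rewrite !fact_natr_neq0 ?nat1r ?natr1 -?natrD !pnatr_eq0.
(* From here on the coefficients enter only through the two-term recurrence [cS]. *)
clearbody c y.
apply/eqP; rewrite -subr_eq0 opprK; apply/eqP.
pose u k : {poly F} := - ((k%:R * (k%:R + a) * c k) *: y ^+ k.-1).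
pose v k : {poly F} := - (((n%:R - k%:R) * c k) *: y ^+ k).
transitivity (\sum_(k < n.+1) (u k - v k)).
  rewrite !raddf_sum /= ?mulr_sumr ?scaler_sumr -!big_split /=.
  apply: eq_bigr => k _; rewrite /u /v.
  move: (c k) (nat_of_ord k) => ck j.
  rewrite !(derivZ, deriv_exp_linear _ dy) !scalerA.
  rewrite -!mul_polyC !(polyCM, polyCN, polyC_natr, polyCD, polyCB, polyC1).
  by case: j => [|[|j]] /=; rewrite ?expr0 ?expr1 ?exprS -?natr1; ring.
apply: sum_shifted_cancel.
- by rewrite /u !mul0r scale0r oppr0.
- by rewrite /v subrr mul0r scale0r oppr0.
by move=> k kn; rewrite /u /v cS.
Qed.

Lemma jacobi_ode a b n :
  (1 - 'X ^+ 2) * (jacobi a b n)^`()^`()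
  + ((b - a)%:P - (a + b + 2%:R) *: 'X) * (jacobi a b n)^`() =
  - ((n%:R * (n%:R + a + b + 1)) *: jacobi a b n).
Proof.
(* Around the singular point 1 the leading coefficient is - y (y + 2), which makes the recurrence
   two-term. The powers of 1/2 go into [c]. *)
pose y : {poly F} := 'X - 1.
pose c k : F := pochhammer (n%:R + a + b + 1) k * pochhammer (a + k%:R + 1) (n - k)
        / (k`!%:R * (n - k)`!%:R) * 2%:R^-1 ^+ k.
have -> : jacobi a b n = \sum_(k < n.+1) c k *: y ^+ k.
  by apply: eq_bigr => k _; rewrite exprZn scalerA.
have dy : y^`() = 1%:P by rewrite derivXsubC.
have -> : 'X = y + 1 by rewrite subrK.
have cS k : (k < n)%N -> 2%:R * (k.+1%:R * (k.+1%:R + a)) * c k.+1 =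
    (n%:R - k%:R) * (n%:R + k%:R + a + b + 1) * c k.
  move=> kn; rewrite /c -(subnK kn) addnK addnS subSn ?leq_addl // addnK.
  rewrite !factS pochhammerSr pochhammerSl.
  have -> : a + k.+1%:R + 1 = a + k%:R + 1 + 1 by rewrite -natr1; ring.
  rewrite -addSn exprS !natrM !natrD -!natr1; field.
  by rewrite !fact_natr_neq0 ?nat1r ?natr1 -?natrD !pnatr_eq0.
clearbody c y.
apply/eqP; rewrite -subr_eq0 opprK; apply/eqP.
pose u k : {poly F} := - ((2%:R * (k%:R * (k%:R + a)) * c k) *: y ^+ k.-1).
pose v k : {poly F} :=
  - (((n%:R - k%:R) * (n%:R + k%:R + a + b + 1) * c k) *: y ^+ k).
transitivity (\sum_(k < n.+1) (u k - v k)).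
  rewrite !raddf_sum /= ?mulr_sumr ?scaler_sumr -!big_split /=.
  apply: eq_bigr => k _; rewrite /u /v.
  move: (c k) (nat_of_ord k) => ck j.
  rewrite !(derivZ, deriv_exp_linear _ dy) !scalerA.
  rewrite -!mul_polyC !(polyCM, polyCN, polyC_natr, polyCD, polyCB, polyC1).
  by case: j => [|[|j]] /=; rewrite ?expr0 ?expr1 ?exprS -?natr1; ring.
apply: sum_shifted_cancel.
- by rewrite /u mul0r mulr0 mul0r scale0r oppr0.
- by rewrite /v subrr !mul0r scale0r oppr0.
by move=> k kn; rewrite /u /v cS.
Qed.
End ODE.

(** * Wronskians with one function replaced *)

Lemma size_derivn_leq (F : fieldType) (p : {poly F}) k :
  p^`(k) != 0 -> (size p^`(k) + k <= size p)%N.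
Proof.
elim: k => [|k IH]; first by rewrite derivn0 addn0.
rewrite derivnS => nz.
have nz' : p^`(k) != 0 by apply: contra_neq nz => ->; rewrite deriv0.
by rewrite addnS -addSn (leq_trans _ (IH nz')) // leq_add2r lt_size_deriv.
Qed.

Section WronskianMatrix.
Variables (F : fieldType) (n : nat).
Implicit Types (f : 'I_n.+1 -> {poly F}) (g : {poly F}).

Definition wronskian_mx f : 'M[{poly F}]_n.+1 := \matrix_(k, i) (f i)^`(k).

Definition replace (T : Type) (f : 'I_n.+1 -> T) (i : 'I_n.+1) (g : T) : 'I_n.+1 -> T :=
  fun j => if j == i then g else f j.

(** Cramer's rule, cleared of denominators, for expressing the column of derivatives of [g] through
    the columns of the [f i]. *)
Lemma wronskian_cramer f g (k : nat) : (k <= n)%N ->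
  \sum_i \det (wronskian_mx (replace f i g)) * (f i)^`(k) =
  \det (wronskian_mx f) * g^`(k).
Proof.
rewrite -ltnS => kn.
pose u : 'cV[{poly F}]_n.+1 := \col_l g^`(l).
have detE i : \det (wronskian_mx (replace f i g)) = (\adj (wronskian_mx f) *m u) i 0.
  rewrite (expand_det_col _ i) mxE; apply: eq_bigr => l _.
  rewrite !mxE /replace eqxx mulrC; congr (_ * _).
  rewrite /cofactor; congr (_ * \det _).
  by apply/matrixP => r c; rewrite !mxE eq_sym (negbTE (neq_lift _ _)).
under eq_bigr do rewrite detE mulrC.
have := congr1 (fun A : 'M_(_, _) => (A *m u) (Ordinal kn) 0) (mul_mx_adj (wronskian_mx f)).
rewrite mul_scalar_mx -mulmxA !mxE => <-.
by apply: eq_bigr => i _; rewrite !mxE.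
Qed.

Lemma wronskian_cancel f (v : 'I_n.+1 -> {poly F}) :
  \det (wronskian_mx f) != 0 ->
  (forall k : nat, (k <= n)%N -> \sum_i v i * (f i)^`(k) = 0) ->
  forall i, v i = 0.
Proof.
move=> W0 vf i.
have Wv : wronskian_mx f *m (\col_j v j) = 0.
  apply/colP => k; rewrite !mxE -[RHS](vf k) -1?ltnS //.
  by apply: eq_bigr => j _; rewrite !mxE mulrC.
have := congr1 (mulmx (\adj (wronskian_mx f))) Wv.
rewrite mulmxA mul_adj_mx mul_scalar_mx mulmx0 => /colP/(_ i).
by rewrite !mxE => /eqP; rewrite mulf_eq0 (negbTE W0) => /eqP.
Qed.

(* [wronskian_cofactor f i] and [wronskian_residual f g], both divided by the
   determinant, are the functions psi and phi of the header. *)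
Definition wronskian_cofactor f i : {poly F} := \adj (wronskian_mx f) i ord_max.

Lemma sum_wronskian_cofactor f (k : nat) : (k <= n)%N ->
  \sum_i wronskian_cofactor f i * (f i)^`(k) =
  if k == n then \det (wronskian_mx f) else 0.
Proof.
rewrite -ltnS => kn.
have := congr1 (fun A : 'M_(_, _) => A (Ordinal kn) ord_max) (mul_mx_adj (wronskian_mx f)).
rewrite !mxE -val_eqE /= -mulrb => <-.
by apply: eq_bigr => i _; rewrite /wronskian_cofactor !mxE mulrC.
Qed.

Definition wronskian_residual f g : {poly F} :=
  \det (wronskian_mx f) * g^`(n.+1)
  - \sum_i \det (wronskian_mx (replace f i g)) * (f i)^`(n.+1).

Lemma wronskian_replace_deriv f g i :
  \det (wronskian_mx f) != 0 ->
  (\det (wronskian_mx (replace f i g)))^`() * \det (wronskian_mx f)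
  - \det (wronskian_mx (replace f i g)) * (\det (wronskian_mx f))^`() =
  wronskian_cofactor f i * wronskian_residual f g.
Proof.
move=> W0; apply/eqP; rewrite -subr_eq0; apply/eqP.
pose Q j : {poly F} := \det (wronskian_mx (replace f j g)).
pose t : {poly F} := \det (wronskian_mx f).
have C k : (k <= n)%N -> \sum_j Q j * (f j)^`(k) = t * g^`(k) by exact: wronskian_cramer.
have A k : (k <= n)%N -> \sum_j wronskian_cofactor f j * (f j)^`(k) = if k == n then t else 0.
  exact: sum_wronskian_cofactor.
have bE : wronskian_residual f g = t * g^`(n.+1) - \sum_j Q j * (f j)^`(n.+1) by [].
move: (wronskian_residual f g) (wronskian_cofactor f) A bE => b a A bE.
rewrite -/(Q i) -/t.
pose v j := (Q j)^`() * t - Q j * t^`() - a j * b.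
apply: (wronskian_cancel (v := v) W0) => k kn; clearbody t Q.
have dC : \sum_j (Q j)^`() * (f j)^`(k) + \sum_j Q j * (f j)^`(k.+1) =
    t^`() * g^`(k) + t * g^`(k.+1).
  rewrite derivnS -derivM -C // raddf_sum -big_split /=.
  by apply: eq_bigr => j _; rewrite derivM -derivnS.
have {}dC : \sum_j (Q j)^`() * (f j)^`(k) =
    t^`() * g^`(k) + t * g^`(k.+1) - \sum_j Q j * (f j)^`(k.+1).
  by rewrite -dC addrK.
have -> : \sum_j v j * (f j)^`(k) =
   t * (\sum_j (Q j)^`() * (f j)^`(k)) - t^`() * (\sum_j Q j * (f j)^`(k))
   - b * \sum_j a j * (f j)^`(k).
  by rewrite !mulr_sumr -!sumrB; apply: eq_bigr => j _; rewrite /v; ring.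
rewrite dC (C k) // (A k) // bE.
case: ltngtP kn => // [kn|->] _; last by ring.
by rewrite C //; ring.
Qed.

Lemma leibniz_sturm (s r p : {poly F}) (s2 r1 : F) (k : nat) :
  s^`()^`() = s2%:P -> r^`() = r1%:P ->
  (s * p^`()^`() + r * p^`())^`(k) =
  s * p^`(k.+2) + (s^`() *+ k + r) * p^`(k.+1)
  + (s2 *+ 'C(k, 2) + r1 *+ k)%:P * p^`(k).
Proof.
move=> hs hr; elim: k => [|k IH].
  by rewrite !mulr0n add0r addr0 polyC0 mul0r addr0 !derivnS derivn0.
rewrite derivnS IH !derivD !derivM derivC -!derivnS derivD derivMn hs hr.
rewrite binS bin1 mulrnDr !polyCD !polyCMn mulrS.
ring.
Qed.

(** Divided by t^2, this is an integrated Lagrange identity: the Wronskian of psi and phi is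
    expressed through F = Q/t itself. The eigenvalues come from the differentiated equations of the
    [f j] and of [g], inserted into the Cramer relations. *)
Lemma wronskian_replace_eigen f g (s r : {poly F}) (s2 r1 e : F) (E : 'I_n.+1 -> F) i :
  s^`()^`() = s2%:P -> r^`() = r1%:P ->
  (forall j, s * (f j)^`()^`() + r * (f j)^`() = - (E j *: f j)) ->
  s * g^`()^`() + r * g^`() = - (e *: g) ->
  \det (wronskian_mx f) != 0 ->
  (E i - e)%:P * (\det (wronskian_mx (replace f i g)) * \det (wronskian_mx f)) =
  s * (wronskian_cofactor f i * (wronskian_residual f g)^`()
       - (wronskian_cofactor f i)^`() * wronskian_residual f g)
  + (s^`() *+ n + r) * (wronskian_cofactor f i * wronskian_residual f g).
Proof.
move=> hs hr hf hg W0; apply/eqP; rewrite -subr_eq0; apply/eqP.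
pose Q j : {poly F} := \det (wronskian_mx (replace f j g)).
pose t : {poly F} := \det (wronskian_mx f).
have C k : (k <= n)%N -> \sum_j Q j * (f j)^`(k) = t * g^`(k) by exact: wronskian_cramer.
have A k : (k <= n)%N -> \sum_j wronskian_cofactor f j * (f j)^`(k) = if k == n then t else 0.
  exact: sum_wronskian_cofactor.
have bE : \sum_j Q j * (f j)^`(n.+1) = t * g^`(n.+1) - wronskian_residual f g.
  by rewrite /wronskian_residual subKr.
have dQ j : (Q j)^`() * t - Q j * t^`() = wronskian_cofactor f j * wronskian_residual f g.
  exact: wronskian_replace_deriv.
move: (wronskian_residual f g) (wronskian_cofactor f) A bE dQ => b a A bE dQ.
rewrite -/(Q i) -/t.
have db : b^`() = t^`() * g^`(n.+1) + t * g^`(n.+2)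
   - \sum_j Q j * (f j)^`(n.+2) - \sum_j (Q j)^`() * (f j)^`(n.+1).
  have -> : b = t * g^`(n.+1) - \sum_j Q j * (f j)^`(n.+1) by rewrite bE subKr.
  rewrite derivB derivM -!derivnS -[RHS]addrA -opprD -big_split /=; congr (_ - _).
  by rewrite raddf_sum; apply: eq_bigr => j _; rewrite /= derivM -derivnS addrC.
pose v j := (E j - e)%:P * (Q j * t) -
  (s * (a j * b^`() - (a j)^`() * b) + (s^`() *+ n + r) * (a j * b)).
apply: (wronskian_cancel (v := v) W0) => k kn; clearbody t Q.
have dA : \sum_j (a j)^`() * (f j)^`(k) =
    (if k == n then t^`() else 0) - \sum_j a j * (f j)^`(k.+1).
  transitivity ((\sum_j a j * (f j)^`(k))^`() - \sum_j a j * (f j)^`(k.+1)).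
    rewrite raddf_sum -sumrB; apply: eq_bigr => j _.
    by rewrite /= derivM -derivnS addrK.
  by rewrite A //; case: eqP; rewrite ?deriv0.
pose c := (s2 *+ 'C(k, 2) + r1 *+ k)%:P.
have Ef : \sum_j Q j * ((E j)%:P * (f j)^`(k)) =
    - (s * (\sum_j Q j * (f j)^`(k.+2)) + (s^`() *+ k + r) * (\sum_j Q j * (f j)^`(k.+1))
       + c * (\sum_j Q j * (f j)^`(k))).
  rewrite !mulr_sumr -!big_split -sumrN /=; apply: eq_bigr => j _.
  have := leibniz_sturm (f j) k hs hr.
  rewrite hf -/c derivnN derivnZ mul_polyC => /eqP; rewrite eqr_oppLR => /eqP ->.
  ring.
have eg : e%:P * g^`(k) = - (s * g^`(k.+2) + (s^`() *+ k + r) * g^`(k.+1) + c * g^`(k)).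
  have := leibniz_sturm g k hs hr.
  by rewrite hg -/c derivnN derivnZ mul_polyC => /eqP; rewrite eqr_oppLR => /eqP ->.
have -> : \sum_j v j * (f j)^`(k) =
   t * (\sum_j Q j * ((E j)%:P * (f j)^`(k))) - e%:P * t * (\sum_j Q j * (f j)^`(k))
   - (s * b^`() + (s^`() *+ n + r) * b) * (\sum_j a j * (f j)^`(k))
   + s * b * \sum_j (a j)^`() * (f j)^`(k).
  rewrite !mulr_sumr -!sumrB -big_split /=; apply: eq_bigr => j _.
  by rewrite /v polyCB; ring.
rewrite Ef dA (C k) // (A k) //.
have eg' : e%:P * t * (t * g^`(k)) =
   - (t * t * (s * g^`(k.+2) + (s^`() *+ k + r) * g^`(k.+1) + c * g^`(k))).
  by rewrite -[RHS]mulrN -eg; ring.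
rewrite {}eg'; case: ltngtP kn => // [kn|k_n] _.
  rewrite (C k.+1) // (A k.+1) //.
  (* The order [k.+2] exceeds [n] exactly when [k.+1 = n]; the residual then enters through [bE]. *)
  move: kn; rewrite leq_eqVlt => /orP[/eqP kn|kn]; first by rewrite kn eqxx bE; ring.
  by rewrite ltn_eqF // C //; ring.
rewrite k_n.
(* At [k = n] Cramer's rule does not reach the order [n.+2]. That sum is recovered from [db], the
   derivative of the residual, once [dQ] has removed the derivatives of the [Q j]. *)
have tdQ : t * (\sum_j (Q j)^`() * (f j)^`(n.+1)) =
   b * (\sum_j a j * (f j)^`(n.+1)) + t^`() * (\sum_j Q j * (f j)^`(n.+1)).
  rewrite !mulr_sumr -big_split; apply: eq_bigr => j _ /=.
  have -> : t * ((Q j)^`() * (f j)^`(n.+1)) = (a j * b + Q j * t^`()) * (f j)^`(n.+1).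
    by rewrite -dQ; ring.
  ring.
have S2 : t * (\sum_j Q j * (f j)^`(n.+2)) = t * t^`() * g^`(n.+1) + t * t * g^`(n.+2)
    - t * b^`() - (b * (\sum_j a j * (f j)^`(n.+1))
                   + t^`() * (t * g^`(n.+1) - b)).
  by rewrite -bE -tdQ db; ring.
rewrite bE; move: S2.
set X := \sum_j Q j * (f j)^`(n.+2); set Y := \sum_j a j * (f j)^`(n.+1) => S2.
ring: S2.
Qed.

(** Every product in the Leibniz expansion takes 0 + 1 + ... + n derivatives in total. If the
    subtraction truncates to 0, the bound says that the determinant vanishes. *)
Lemma size_wronskian f (A : 'I_n.+1 -> nat) :
  (forall i, (size (f i) <= (A i).+1)%N) ->
  (size (\det (wronskian_mx f)) <= (\sum_i A i).+1 - \sum_(i < n.+1) i)%N.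
Proof.
move=> fA; apply: leq_trans (size_sum _ _ _) _; apply/bigmax_leqP => p _.
rewrite size_Msign.
(* A zero factor must be set aside: its size does not obey the bound on sizes of derivatives. *)
have [/eqP->|nz] := boolP (\prod_i wronskian_mx f i (p i) == 0); first by rewrite size_poly0.
rewrite (eq_bigr (fun i : 'I_n.+1 => (f (p i))^`(i))); last by move=> i _; rewrite mxE.
apply: leq_trans (size_poly_prod_leq _ _) _.
have fi (i : 'I_n.+1) : (size ((f (p i))^`(i)) + i <= (A (p i)).+1)%N.
  have : (f (p i))^`(i) != 0.
    by move/prodf_neq0: nz => /(_ i isT); rewrite mxE.
  move=> /size_derivn_leq /leq_trans; apply; exact: fA.
have : (\sum_(i < n.+1) (size ((f (p i))^`(i)) + i) <= \sum_(i < n.+1) (A (p i)).+1)%N.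
  by apply: leq_sum => i _; exact: fi.
rewrite big_split /=.
have -> : (\sum_i (A (p i)).+1 = \sum_i A i + n.+1)%N.
  transitivity (\sum_(i < n.+1) (A i).+1)%N; first by rewrite [RHS](reindex_perm p).
  rewrite (eq_bigr (fun i => A i + 1)%N) => [|i _]; last by rewrite addn1.
  by rewrite big_split sum_nat_const card_ord muln1.
rewrite card_ord.
by move: (\sum_(i < n.+1) size _) (\sum_(i < n.+1) i) (\sum_i A i) => a b c; lia.
Qed.

End WronskianMatrix.

(** * Residues at the zeros of a Wronskian *)

Section Residues.
Variables (F : numFieldType) (N : nat) (t : {poly F}) (x : 'I_N -> F).
Hypotheses (size_t : size t = N.+1) (rx : forall l, root t (x l)) (xI : injective x).

(** The quotient of [t] by ['X - (x l)%:P], as a product showing its zeros and leading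
    coefficient. *)
Let cofac l : {poly F} := lead_coef t *: \prod_(k | k != l) ('X - (x k)%:P).

Let tE l : t = ('X - (x l)%:P) * cofac l.
Proof.
rewrite {1}(@all_roots_prod_XsubC _ t (codom x)).
- by rewrite big_image (bigD1 l) //= -scalerAr.
- by rewrite size_codom card_ord.
- by apply/allP => _ /codomP[j ->].
- by rewrite uniq_rootsE map_inj_uniq ?enum_uniq.
Qed.

Let t_neq0 : t != 0.
Proof. by rewrite -size_poly_gt0 size_t. Qed.

Let t'E l : t^`().[x l] = (cofac l).[x l].
Proof. by rewrite (tE l) derivM derivXsubC !hornerE subrr mul0r addr0. Qed.

Let t''E l : t^`()^`().[x l] = 2%:R * (cofac l)^`().[x l].
Proof.
rewrite (tE l); move: (cofac l) => p.
by rewrite !(derivM, derivXsubC, derivD, derivC) !hornerE subrr /=; ring.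
Qed.

Lemma deriv_simple_root_neq0 l : t^`().[x l] != 0.
Proof.
rewrite t'E /cofac hornerZ mulf_neq0 ?lead_coef_eq0 //.
rewrite horner_prod; apply/prodf_neq0 => k kl.
by rewrite hornerXsubC subr_eq0 (inj_eq xI) eq_sym.
Qed.
Let t'0 := deriv_simple_root_neq0.

Let cofac0 l k : k != l -> (cofac l).[x k] = 0.
Proof.
by move=> kl; rewrite /cofac hornerZ horner_prod (bigD1 k) //= hornerXsubC subrr mul0r mulr0.
Qed.

Let size_cofac l : size (cofac l) = N.
Proof.
have : size t = (size (cofac l)).+1.
  rewrite {1}(tE l) size_monicM ?monicXsubC ?size_XsubC //.
  by apply: contra_neq (t'0 l); rewrite t'E => ->; rewrite horner0.
by rewrite size_t => -[].
Qed.

Let lead_cofac l : (cofac l)`_N.-1 = lead_coef t.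
Proof.
by rewrite -{1}(size_cofac l) -/(lead_coef _) /cofac lead_coefZ lead_coef_prod big1 ?mulr1 // => k _; rewrite lead_coefXsubC.
Qed.

(** Lagrange interpolation at the roots of [t], followed by comparison of the coefficients of degree
    [N.-1]. The strict size bound means that A/t has no residue at infinity. *)
Lemma sum_residues_simple (A : {poly F}) : (size A < N)%N ->
  \sum_l A.[x l] / t^`().[x l] = 0.
Proof.
move=> sA.
have AE : A = \sum_l (A.[x l] / t^`().[x l]) *: cofac l.
  apply/eqP; rewrite -subr_eq0; apply/eqP.
  apply: (@roots_geq_poly_eq0 _ _ (codom x)).
  - apply/allP => _ /codomP[k ->]; rewrite rootE hornerD hornerN horner_sum.
    rewrite (bigD1 k) //= big1 => [|l lk]; last by rewrite hornerZ cofac0 ?mulr0 // eq_sym.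
    by rewrite addr0 hornerZ -t'E divfK ?subrr.
  - by rewrite map_inj_uniq ?enum_uniq.
  rewrite size_codom card_ord; apply: leq_trans (size_polyD _ _) _.
  rewrite geq_max size_polyN (ltnW sA) /=.
  apply: leq_trans (size_sum _ _ _) _; apply/bigmax_leqP => l _.
  by rewrite (leq_trans (size_scale_leq _ _)) ?size_cofac.
have /eqP := congr1 (fun p : {poly F} => p`_N.-1) AE.
rewrite nth_default; last by case: N sA.
rewrite coef_sum.
under eq_bigr do rewrite coefZ lead_cofac.
rewrite -mulr_suml eq_sym mulf_eq0 lead_coef_eq0 (negbTE t_neq0) orbF => /eqP.
by [].
Qed.

(* The residue of W / t^2 at a simple zero z of t. *)
Definition double_pole_residue (W : {poly F}) (z : F) : F :=
  (W^`().[z] * t^`().[z] - W.[z] * t^`()^`().[z]) / t^`().[z] ^+ 3.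

(* Subtracting the terms W(x_l) / t'(x_l)^2 * (t / (X - x_l))^2, which carry no
   residue, reduces W / t^2 to a form A / t with simple poles. *)
Lemma sum_residues_double (W : {poly F}) : (size W < N.*2)%N ->
  \sum_l double_pole_residue W (x l) = 0.
Proof.
move=> sW; clearbody cofac.
pose B := W - \sum_l (W.[x l] / t^`().[x l] ^+ 2) *: cofac l ^+ 2.
have B0 k : B.[x k] = 0.
  rewrite hornerD hornerN horner_sum (bigD1 k) //= big1 => [|l lk].
    by rewrite addr0 hornerZ horner_exp -t'E divfK ?subrr // expf_neq0.
  by rewrite hornerZ horner_exp cofac0 1?eq_sym // expr0n mulr0.
have tB : t %| B.
  rewrite (@all_roots_prod_XsubC _ t (codom x)).
  - rewrite dvdpZl ?lead_coef_eq0 // uniq_roots_dvdp //.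
      by apply/allP => _ /codomP[l ->]; rewrite rootE B0.
    by rewrite uniq_rootsE map_inj_uniq ?enum_uniq.
  - by rewrite size_codom card_ord.
  - by apply/allP => _ /codomP[j ->].
  - by rewrite uniq_rootsE map_inj_uniq ?enum_uniq.
case/dvdpP: tB => A BE.
have WE : W = A * t + \sum_l (W.[x l] / t^`().[x l] ^+ 2) *: cofac l ^+ 2.
  by rewrite -BE subrK.
have resE k : double_pole_residue W (x k) = A.[x k] / t^`().[x k].
  have tk : t.[x k] = 0 by apply/eqP; exact: rx.
  pose S := \sum_(l | l != k) (W.[x l] / t^`().[x l] ^+ 2) *: cofac l ^+ 2.
  have S0 : S.[x k] = 0.
    rewrite horner_sum big1 // => l lk.
    by rewrite hornerZ horner_exp cofac0 1?eq_sym // expr0n mulr0.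
  have S1 : S^`().[x k] = 0.
    rewrite raddf_sum horner_sum big1 // => l lk /=.
    by rewrite derivZ hornerZ deriv_exp hornerMn hornerM horner_exp cofac0 1?eq_sym // expr1 mulr0 mul0rn mulr0.
  (* The terms in [S] vanish doubly at [x k], so only the [k]-th square and [A * t] contribute. *)
  rewrite /double_pole_residue {1}WE (bigD1 k) //= -/S.
  rewrite !(derivD, derivM, derivZ, deriv_exp) !hornerE S1 tk t''E -t'E /= ?expr1.
  rewrite -mulr_natl.
  have := t'0 k; set T := t^`().[x k] => T0; set w := W.[x k].
  by field.
under eq_bigr do rewrite resE.
apply: sum_residues_simple.
have [->|A0] := eqVneq A 0; first by rewrite size_poly0; case: N sW.
have : (size (A * t)%R < N.*2)%N.
  rewrite -BE; apply: leq_ltn_trans (size_polyD _ _) _.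
  rewrite gtn_max sW size_polyN /=.
  apply: leq_ltn_trans (size_sum _ _ _) _.
  have N0 : (0 < N)%N by case: N sW.
  apply: (@leq_ltn_trans N.*2.-1); last by rewrite prednK // double_gt0.
  apply/bigmax_leqP => l _.
  apply: leq_trans (size_scale_leq _ _) _; apply: leq_trans (size_poly_exp_leq _ _) _.
  rewrite size_cofac; lia.
by rewrite size_mul // size_t addnS -addnn ltn_add2r.
Qed.

End Residues.

(** A purely local computation: the hypotheses and their derivatives are evaluated at [z] and become
    relations between numbers. The mixed pairs [Q12] and [Q21] supply the eigenvalues, as (E1 - e2)
    - (E2 - e1). *)
Lemma residue_wronskian_ratio (F : numFieldType) (t s k a1 a2 b1 b2 Q11 Q12 Q21 Q22 : {poly F})
    (E1 E2 e1 e2 z : F) :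
  root t z -> t^`().[z] != 0 -> s.[z] != 0 ->
  Q11^`() * t - Q11 * t^`() = a1 * b1 -> Q12^`() * t - Q12 * t^`() = a1 * b2 ->
  Q21^`() * t - Q21 * t^`() = a2 * b1 -> Q22^`() * t - Q22 * t^`() = a2 * b2 ->
  (E1 - e2)%:P * (Q12 * t) = s * (a1 * b2^`() - a1^`() * b2) + k * (a1 * b2) ->
  (E2 - e1)%:P * (Q21 * t) = s * (a2 * b1^`() - a2^`() * b1) + k * (a2 * b1) ->
  double_pole_residue t (Q11 * Q22^`() - Q11^`() * Q22) z =
  (E1 + e1 - E2 - e2) * (Q11.[z] * Q22.[z] / (s.[z] * t^`().[z] ^+ 2)).
Proof.
move=> /rootP tz T0 s0 d11 d12 d21 d22 h12 h21.
have ev (p q : {poly F}) : p = q -> [/\ p.[z] = q.[z], p^`().[z] = q^`().[z]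
    & p^`()^`().[z] = q^`()^`().[z]] by move=> ->.
have [v11 _ w11] := ev _ _ d11.
have [v12 u12 _] := ev _ _ d12.
have [v21 u21 _] := ev _ _ d21.
have [v22 _ w22] := ev _ _ d22.
have [x12 y12 _] := ev _ _ h12.
have [x21 y21 _] := ev _ _ h21.
move: v11 v12 v21 v22 u12 u21 w11 w22 x12 x21 y12 y21.
rewrite /double_pole_residue !(derivB, derivD, derivM, derivC).
rewrite !(hornerD, hornerN, hornerM, hornerC) tz.
move: T0 s0.
move: t^`().[z] t^`()^`().[z] t^`()^`()^`().[z] s.[z] s^`().[z] => T T2 T3 S S1 T0 S0.
move: k.[z] k^`().[z] => K K1.
move: a1.[z] a1^`().[z] a1^`()^`().[z] => p p1 p2.
move: a2.[z] a2^`().[z] a2^`()^`().[z] => q q1 q2.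
move: b1.[z] b1^`().[z] b1^`()^`().[z] => f f1 f2.
move: b2.[z] b2^`().[z] b2^`()^`().[z] => g g1 g2.
move: Q11.[z] Q11^`().[z] Q11^`()^`().[z] => A A1 A2.
move: Q12.[z] Q12^`().[z] Q12^`()^`().[z] => B B1 B2.
move: Q21.[z] Q21^`().[z] Q21^`()^`().[z] => C C1 C2.
move: Q22.[z] Q22^`().[z] Q22^`()^`().[z] => D D1 D2.
move=> v11 v12 v21 v22 u12 u21 w11 w22 x12 x21 y12 y21.
(* Since [t] vanishes at [z], the factorization determines each value Q(z) = - a b / t'. *)
have solve (x y w : F) : x * 0 - y * T = w -> y = - (w / T).
  by move=> <-; field.
move: (solve _ _ _ v11) (solve _ _ _ v12) (solve _ _ _ v21) (solve _ _ _ v22) => eA eB eC eD.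
(* [u] and [v] are the common logarithmic derivatives at [z] of the a's and of the b's, kept
   multiplied by a b since these may vanish. Their sum comes from the differentiated factorization,
   their difference from the eigenvalue identity. *)
pose u := (T2 / T + K / S) / 2%:R; pose v := (T2 / T - K / S) / 2%:R.
have sum_diff (a a' b b' y y1 y2 e : F) : y = - (a * b / T) ->
    y2 * 0 + y1 * T - (y1 * T + y * T2) = a' * b + a * b' ->
    e * (y * 0) = S * (a * b' - a' * b) + K * (a * b) ->
    a' * b = u * (a * b) /\ a * b' = v * (a * b).
  move=> ey es ed.
  have es' : a' * b + a * b' = T2 / T * (a * b) by rewrite -es ey; field.
  have ed' : a * b' - a' * b = - (K / S) * (a * b).
    by apply: (mulfI S0); apply: (addIr (K * (a * b))); rewrite -ed; field.
  split; apply: (mulfI (_ : 2%:R != 0 :> F)); rewrite ?pnatr_eq0 //.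
    by transitivity (a' * b + a * b' - (a * b' - a' * b)); [ring | rewrite es' ed' /u; field; rewrite T0 S0].
  by transitivity (a' * b + a * b' + (a * b' - a' * b)); [ring | rewrite es' ed' /v; field; rewrite T0 S0].
have [k12 l12] := sum_diff _ _ _ _ _ _ _ _ eB u12 x12.
have [k21 l21] := sum_diff _ _ _ _ _ _ _ _ eC u21 x21.
(* [H] is the part of (a b'' - a'' b) / (a b) common to both mixed pairs; only the eigenvalue term
   distinguishes them. *)
pose H := - (S1 * (v - u) + K1 + K * (u + v)) / S.
have second (a a' a'' b b' b'' y y1 e : F) : y = - (a * b / T) ->
    a' * b = u * (a * b) -> a * b' = v * (a * b) ->
    0 * (y * 0) + e * (y1 * 0 + y * T) = S1 * (a * b' - a' * b)
      + S * (a' * b' + a * b'' - (a'' * b + a' * b')) + (K1 * (a * b) + K * (a' * b + a * b')) ->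
    a * b'' - a'' * b = (H - e / S) * (a * b).
  move=> ey hu hv ed; apply: (mulfI S0).
  have -> : S * (a * b'' - a'' * b) = e * y * T
      - (S1 * (a * b' - a' * b) + (K1 * (a * b) + K * (a' * b + a * b'))).
    by move: ed; rewrite !(mulr0, mul0r, add0r) => ed; rewrite -mulrA ed; ring.
  by rewrite hu hv ey /H; field; rewrite T0 S0.
have m12 := second _ _ _ _ _ _ _ _ _ eB k12 l12 y12.
have m21 := second _ _ _ _ _ _ _ _ _ eC k21 l21 y21.
have {}w11 : A2 * T - A1 * T2 = A * T3 + (p2 * f + p1 * f1 + (p1 * f1 + p * f2)).
  by rewrite -w11; ring.
have {}w22 : D2 * T - D1 * T2 = D * T3 + (q2 * g + q1 * g1 + (q1 * g1 + q * g2)).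
  by rewrite -w22; ring.
transitivity ((A * (D2 * T - D1 * T2) - D * (A2 * T - A1 * T2)) / T ^+ 3).
  by congr (_ / _); ring.
rewrite w11 w22 eA eD.
(* Regrouping by the mixed pairs makes [m12] and [m21] applicable. [H] then cancels, and the last
   bracket vanishes as v u - u v. *)
transitivity (- ((q * f) * (p * g2 - p2 * g) - (p * g) * (q * f2 - q2 * f)
   + 2%:R * ((p * g1) * (q1 * f) - (p1 * g) * (q * f1))) / T ^+ 4).
  by field.
rewrite m12 m21 k12 k21 l12 l21.
by field; rewrite T0 S0.
Qed.

(** * Orthogonality *)

Section Orthogonality.
Variables (F : numFieldType) (s r : {poly F}) (s2 r1 : F).
Variables (P : nat -> {poly F}) (E : nat -> F).
Hypotheses (hs : s^`()^`() = s2%:P) (hr : r^`() = r1%:P).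
Hypothesis ode : forall n, s * (P n)^`()^`() + r * (P n)^`() = - (E n *: P n).
Hypothesis size_P : forall n, (size (P n) <= n.+1)%N.
Hypothesis E_inj : injective E.

Variables (n : nat) (A : 'I_n.+1 -> nat) (Nz : nat) (x : 'I_Nz -> F).
Let f i := P (A i).
Let t := \det (wronskian_mx f).
Let Q i e := \det (wronskian_mx (replace f i (P e))).
Hypothesis A_inj : injective A.
Hypothesis Nz_E : (Nz + \sum_(i < n.+1) i = \sum_i A i)%N.
Hypothesis size_t : size t = Nz.+1.
Hypothesis root_t : forall l, root t (x l).
Hypothesis x_inj : injective x.
Hypothesis s_x : forall l, s.[x l] != 0.

Let t_neq0 : t != 0.
Proof. by rewrite -size_poly_gt0 size_t. Qed.

Let size_Q i e : Q i e != 0 -> (size (Q i e) + A i <= Nz + e.+1)%N.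
Proof.
rewrite -size_poly_gt0 => Q0.
have := @size_wronskian _ _ (replace f i (P e)) (replace A i e).
have H j : (size (replace f i (P e) j) <= (replace A i e j).+1)%N.
  by rewrite /replace; case: eqP => _; exact: size_P.
move=> /(_ H); rewrite -/(Q i e).
have : (\sum_j replace A i e j + A i = \sum_j A j + e)%N.
  rewrite (bigD1 i) // [in RHS](bigD1 i) //= {1}/replace eqxx.
  rewrite (eq_bigr A) => [|j ji]; last by rewrite /replace (negbTE ji).
  lia.
move: Nz_E Q0.
move: (size _) (\sum_(j < n.+1) j)%N (\sum_j replace A i e j)%N (\sum_j A j)%N => a b c d; lia.
Qed.

Let weight i1 e1 i2 e2 l :=
  (Q i1 e1).[x l] * (Q i2 e2).[x l] / (s.[x l] * t^`().[x l] ^+ 2).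

(** The degree bound excludes a residue at infinity. It constrains only the sum [e1 + e2], so that
    it survives exchanging [e1] and [e2]. *)
Let weighted_sum i1 i2 e1 e2 : (e1 + e2 + 2 <= A i1 + A i2)%N ->
  (E (A i1) + E e1 - E (A i2) - E e2) * \sum_l weight i1 e1 i2 e2 l = 0.
Proof.
move=> lt_e.
have [Q1|Q1] := eqVneq (Q i1 e1) 0.
  by rewrite big1 ?mulr0 // => l _; rewrite /weight Q1 horner0 !mul0r.
have [Q2|Q2] := eqVneq (Q i2 e2) 0.
  by rewrite big1 ?mulr0 // => l _; rewrite /weight Q2 horner0 mulr0 mul0r.
have sQ : (size (Q i1 e1) + size (Q i2 e2) <= Nz.*2)%N.
  by have := size_Q Q1; have := size_Q Q2; lia.
have Q1_gt0 : (0 < size (Q i1 e1))%N by rewrite size_poly_gt0.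
have size_M (p q : {poly F}) : (size p + size q <= Nz.*2)%N -> (0 < Nz)%N ->
    (size (p * q^`())%R < Nz.*2)%N.
  move=> pq N0; apply: leq_ltn_trans (size_polyMleq _ _) _.
  have : (size q^`() <= size q)%N.
    by have [->|/lt_size_deriv/ltnW//] := eqVneq q 0; rewrite deriv0.
  lia.
have N0 : (0 < Nz)%N by move: sQ Q1_gt0; case: (Nz); lia.
rewrite mulr_sumr; have := @sum_residues_double _ _ t x size_t root_t x_inj
  (Q i1 e1 * (Q i2 e2)^`() - (Q i1 e1)^`() * Q i2 e2).
move=> res0; rewrite -[RHS]res0; last first.
  apply: leq_ltn_trans (size_polyD _ _) _; rewrite gtn_max size_polyN size_M //=.
  by rewrite mulrC size_M // addnC.
apply: eq_bigr => l _; apply/esym.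
have D i e := wronskian_replace_deriv (P e) i t_neq0.
have H i e := wronskian_replace_eigen i hs hr (fun j => ode (A j)) (ode e) t_neq0.
apply: (residue_wronskian_ratio (root_t l) _ (s_x l) (D _ _) (D i1 e2) (D i2 e1) (D _ _)
  (H _ _) (H _ _)).
exact: deriv_simple_root_neq0.
Qed.

Lemma wronskian_zeros_orthogonality i1 i2 e1 e2 :
  (e1 < A i1)%N -> (e2 < A i2)%N -> (i1, e1) != (i2, e2) ->
  \sum_l (Q i1 e1).[x l] * (Q i2 e2).[x l] / (s.[x l] * t^`().[x l] ^+ 2) = 0.
Proof.
move=> h1 h2 ne; apply/eqP.
have lt_e : (e1 + e2 + 2 <= A i1 + A i2)%N by lia.
have /eqP := weighted_sum lt_e; rewrite mulf_eq0 => /orP[/eqP E1|//].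
have D i e := wronskian_replace_deriv (P e) i t_neq0.
have Qx i e l : (Q i e).[x l] * t^`().[x l] =
    - ((wronskian_cofactor f i).[x l] * (wronskian_residual f (P e)).[x l]).
  have := congr1 (fun p : {poly F} => p.[x l]) (D i e).
  rewrite !(hornerD, hornerN, hornerM) -/t -/(Q i e) (rootP (root_t l)) mulr0 add0r.
  by move=> <-; rewrite opprK.
(* Both sides are a_i1 b_e1 a_i2 b_e2 / t'^2 at a zero of t. *)
have swap l : weight i1 e2 i2 e1 l = weight i1 e1 i2 e2 l.
  rewrite /weight; congr (_ / _).
  have T0 := deriv_simple_root_neq0 size_t root_t x_inj l.
  apply: (mulIf T0); apply: (mulIf T0).
  have R (a b c : F) : a * b * c * c = (a * c) * (b * c) by ring.
  by rewrite !R !Qx; ring.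
have lt_e' : (e2 + e1 + 2 <= A i1 + A i2)%N by rewrite (addnC e2).
have /eqP := weighted_sum lt_e'; rewrite (eq_bigr _ (fun l _ => swap l)).
rewrite mulf_eq0 => /orP[/eqP E2|//].
(* Adding [E1] and [E2] cancels the eigenvalues of [e1] and [e2]. *)
have eA : E (A i1) = E (A i2).
  apply/eqP; rewrite -subr_eq0; apply/eqP/(mulfI (_ : 2%:R != 0 :> F)); rewrite ?pnatr_eq0 //.
  by rewrite mulr0 -[RHS]addr0 -{1}E1 -E2; ring.
have ee : E e1 = E e2 by apply/eqP; rewrite -subr_eq0 -E1 eA; apply/eqP; ring.
by move: ne; rewrite (A_inj (E_inj eA)) (E_inj ee) eqxx.
Qed.
End Orthogonality.

(** * The three families as instances of one differential equation *)

Section BaseODE.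
Variable R : realType.
Implicit Types c : family R.

Definition ode_lead c : {poly R} :=
  match c with CaseH => 1 | CaseL _ => 'X | CaseJ _ _ => 1 - 'X ^+ 2 end.

Definition ode_drift c : {poly R} :=
  match c with
  | CaseH => - (2%:R *: 'X)
  | CaseL g => (g - 2%:R^-1 + 1)%:P - 'X
  | CaseJ g h => (h - g)%:P - (g + h + 1) *: 'X
  end.

Definition ode_eigenvalue c (n : nat) : R :=
  match c with
  | CaseH => (2 * n)%:R
  | CaseL _ => n%:R
  | CaseJ g h => n%:R * (n%:R + g + h)
  end.

Lemma real_base_poly_ode c n :
  ode_lead c * (real_base_poly c n)^`()^`() + ode_drift c * (real_base_poly c n)^`() =
  - (ode_eigenvalue c n *: real_base_poly c n).
Proof.
case: c => [|g|g h] /=.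
- by rewrite mul1r mulNr hermite_ode.
- by rewrite laguerre_ode.
have := jacobi_ode (g - 2%:R^-1) (h - 2%:R^-1) n.
have -> : h - 2%:R^-1 - (g - 2%:R^-1) = h - g by ring.
have -> : g - 2%:R^-1 + (h - 2%:R^-1) + 2%:R = g + h + 1 by field.
have -> : n%:R + (g - 2%:R^-1) + (h - 2%:R^-1) + 1 = n%:R + g + h by field.
by [].
Qed.

Lemma size_base_poly c n : (size (base_poly c n) <= n.+1)%N.
Proof.
rewrite size_map_poly; case: c => [|g|g h] /=.
- exact: size_hermite.
- exact: size_laguerre.
- exact: size_jacobi.
Qed.

Lemma base_poly_ode c n :
  map_poly (real_complex R) (ode_lead c) * (base_poly c n)^`()^`()
  + map_poly (real_complex R) (ode_drift c) * (base_poly c n)^`() =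
  - ((ode_eigenvalue c n)%:C%C *: base_poly c n).
Proof.
rewrite /base_poly !deriv_map -!rmorphM -rmorphD /= real_base_poly_ode.
by rewrite rmorphN /= map_polyZ.
Qed.

(** In the Jacobi case a coincidence with [m != n] would force m + n + g + h = 0, which g + h > 0
    excludes. *)
Lemma ode_eigenvalue_inj c : admissible c -> injective (ode_eigenvalue c).
Proof.
case: c => [|g|g h] /= hc m n.
- by move/eqP; rewrite eqr_nat eqn_pmul2l // => /eqP.
- by move/eqP; rewrite eqr_nat => /eqP.
move=> /eqP; rewrite -subr_eq0.
have -> : m%:R * (m%:R + g + h) - n%:R * (n%:R + g + h) =
  (m%:R - n%:R) * (m%:R + n%:R + (g + h)) by ring.
have gh : 0 < g + h.
  have half_gt0 : 0 < 2%:R^-1 :> R by rewrite invr_gt0 ltr0n.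
  by rewrite addr_gt0 // (lt_trans half_gt0); case: hc.
rewrite mulf_eq0 subr_eq0 eqr_nat (gt_eqF (ltr_wpDl _ gh)) ?addr_ge0 ?ler0n //.
by rewrite orbF => /eqP.
Qed.

Lemma ode_lead_deriv2 c : exists a : R, (ode_lead c)^`()^`() = a%:P.
Proof.
case: c => [|g|g h] /=.
- by exists 0; rewrite -polyC1 !derivC.
- by exists 0; rewrite derivX -polyC1 !derivC.
exists (- 2%:R); rewrite derivB -polyC1 derivC sub0r expr2 derivM derivX.
by rewrite derivN mul1r mulr1 derivD derivX polyCN polyC_natr.
Qed.

Lemma ode_drift_deriv c : exists a : R, (ode_drift c)^`() = a%:P.
Proof.
case: c => [|g|g h] /=.
- by exists (- 2%:R); rewrite derivN derivZ derivX alg_polyC polyCN.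
- by exists (- 1); rewrite derivB derivC derivX sub0r polyCN.
- by exists (- (g + h + 1)); rewrite derivB derivC derivZ derivX alg_polyC sub0r polyCN.
Qed.

(** This identifies the weight of the theorem with the leading coefficient [s] of the abstract
    setting, up to a constant factor. *)
Lemma eta_dot_sqE c : exists2 k : R[i], k != 0 &
  forall z, eta_dot_sq c z = k * (map_poly (real_complex R) (ode_lead c)).[z].
Proof.
have four : 4%:R != 0 :> R[i] by rewrite pnatr_eq0.
case: c => [|g|g h] /=.
- by exists 1; rewrite ?oner_neq0 // => z; rewrite rmorph1 hornerC mulr1.
- by exists 4%:R => // z; rewrite map_polyX hornerX.
by exists 4%:R => // z; rewrite rmorphB rmorph1 rmorphXn /= map_polyX !hornerE.
Qed.

Lemma ode_lead_neq0 c z : not_endpoint c z ->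
  (map_poly (real_complex R) (ode_lead c)).[z] != 0.
Proof.
case: c => [|g|g h] /=.
- by rewrite rmorph1 hornerC oner_neq0.
- by rewrite map_polyX hornerX => /eqP.
rewrite rmorphB rmorph1 rmorphXn /= map_polyX !hornerE => -[/eqP z1 /eqP zN1].
by rewrite subr_eq0 eq_sym sqrf_eq1 negb_or z1.
Qed.

End BaseODE.

(** * Passage to Krein-Adler polynomials *)

Lemma wronskian_mxE (F : fieldType) (n : nat) (P : nat -> {poly F}) (A : seq nat)
    (f : 'I_n.+1 -> {poly F}) :
  size A = n.+1 -> (forall i : 'I_n.+1, P (nth 0%N A i) = f i) ->
  wronskian (map P A) = \det (wronskian_mx f).
Proof.
move=> sA Af; rewrite /wronskian.
have: size (map P A) = n.+1 by rewrite size_map.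
have Anth i : (i < n.+1)%N -> nth 0 (map P A) i = P (nth 0%N A i).
  by move=> ltin; rewrite (nth_map 0%N) // sA.
(* The matrix dimension depends on the size of the list; generalizing the list allows that size to
   be rewritten. *)
move: (map P A) Anth => fs Anth sfs; rewrite sfs.
by congr (\det _); apply/matrixP => k i; rewrite !mxE Anth // Af.
Qed.

(** The common source of the three relations: all their numerators replace one entry of [rcons D N]
    by a smaller index. *)
Lemma krein_adler_orthogonality (R : realType) (c : family R) (D : seq nat) (N : nat)
    (eta : 'I_(ell' D + N) -> R[i]) (i1 i2 : 'I_(size D).+1) (e1 e2 : nat) :
  let A := nth 0%N (rcons D N) in
  let f (i : 'I_(size D).+1) := base_poly c (A i) in
  let Q i e := \det (wronskian_mx (replace f i (base_poly c e))) in
  admissible c -> increasing_positive D -> N \notin D ->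
  size (krein_adler_poly c D N) = (ell' D + N).+1 ->
  (forall l, root (krein_adler_poly c D N) (eta l)) -> injective eta ->
  (forall l, not_endpoint c (eta l)) ->
  (e1 < A i1)%N -> (e2 < A i2)%N -> (i1, e1) != (i2, e2) ->
  \sum_l ((Q i1 e1).[eta l] * (Q i2 e2).[eta l])
    / (eta_dot_sq c (eta l) * ((krein_adler_poly c D N)^`()).[eta l] ^+ 2) = 0.
Proof.
move=> A f Q hc [D_sorted _] ND size_t root_t eta_inj ends lt1 lt2 ne.
have tE : krein_adler_poly c D N = \det (wronskian_mx f).
  by rewrite /krein_adler_poly -map_rcons; apply: wronskian_mxE; rewrite ?size_rcons.
rewrite tE in size_t root_t *.
have [k k0 kE] := eta_dot_sqE c.
have [s2 hs] := ode_lead_deriv2 c; have [r1 hr] := ode_drift_deriv c.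
have A_inj : injective (fun i : 'I_(size D).+1 => A i).
  move=> i j /eqP; rewrite /A nth_uniq ?size_rcons // => [/eqP/val_inj//|].
  by rewrite rcons_uniq ND (sorted_uniq ltn_trans ltnn).
have sumA : (\sum_(i < (size D).+1) A i = \sum_(d <- D) d + N)%N.
  rewrite -(size_rcons D N) -(big_mkord xpredT A) -(big_nth _ xpredT id).
  by rewrite -cats1 big_cat big_seq1.
have sum_ord : (\sum_(i < (size D).+1) i = (size D * (size D).+1)./2)%N.
  by rewrite -(big_mkord xpredT id) bin2_sum bin2 mulnC.
(* The assumed exact degree, confronted with the bound [size_wronskian], shows that the subtraction
   in [ell'] is not truncated. *)
have Nz_E : (ell' D + N + \sum_(i < (size D).+1) i = \sum_(i < (size D).+1) A i)%N.
  have := @size_wronskian _ _ f (fun i => A i) (fun i => size_base_poly c (A i)).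
  rewrite size_t sumA sum_ord /ell'.
  move: (\sum_(d <- D) d)%N (_./2) => a b; lia.
have hs' : (map_poly (real_complex R) (ode_lead c))^`()^`() = (s2%:C%C)%:P.
  by rewrite !deriv_map hs map_polyC.
have hr' : (map_poly (real_complex R) (ode_drift c))^`() = (r1%:C%C)%:P.
  by rewrite deriv_map hr map_polyC.
have E_inj : injective (fun n => (ode_eigenvalue c n)%:C%C).
  by move=> m n /(fmorph_inj (real_complex R)) /(ode_eigenvalue_inj hc).
have := wronskian_zeros_orthogonality hs' hr' (base_poly_ode c) (size_base_poly c) E_inj
  A_inj Nz_E size_t root_t eta_inj (fun l => ode_lead_neq0 (ends l)) lt1 lt2 ne.
move=> /(congr1 ( *%R k^-1)); rewrite mulr0 mulr_sumr => sum0; rewrite -[RHS]sum0.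
by apply: eq_bigr => l _; rewrite kE !invfM; ring.
Qed.

Lemma krein_adler_replace_last (R : realType) (c : family R) (D : seq nat) (N m : nat) :
  krein_adler_poly c D m =
  \det (wronskian_mx (replace (fun i : 'I_(size D).+1 => base_poly c (nth 0%N (rcons D N) i))
    ord_max (base_poly c m))).
Proof.
rewrite /krein_adler_poly -map_rcons; apply: wronskian_mxE; rewrite ?size_rcons // => i.
rewrite /replace -val_eqE /= !nth_rcons.
case: eqVneq => [->|ne]; first by rewrite ltnn.
by have := ltn_ord i; rewrite ltnS leq_eqVlt (negbTE ne) /= => ->.
Qed.

Lemma krein_adler_replace (R : realType) (c : family R) (D : seq nat) (N j e : nat)
    (lt_jD : (j < (size D).+1)%N) : (j < size D)%N ->
  krein_adler_poly c (set_nth 0%N D j e) N =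
  \det (wronskian_mx (replace (fun i : 'I_(size D).+1 => base_poly c (nth 0%N (rcons D N) i))
    (Ordinal lt_jD) (base_poly c e))).
Proof.
move=> jD; have sD : size (set_nth 0%N D j e) = size D by rewrite size_set_nth; exact/maxn_idPr.
rewrite /krein_adler_poly -map_rcons; apply: wronskian_mxE; rewrite ?size_rcons ?sD // => i.
rewrite /replace -val_eqE /= !nth_rcons sD nth_set_nth /=.
by case: (eqVneq (val i) j) => [->|//]; rewrite jD.
Qed.

Theorem mainTheorem8 (R : realType) (c : family R) (D : seq nat) (N : nat)
    (eta : 'I_(ell' D + N) -> R[i])
    (hc : admissible c)
    (hD : increasing_positive D)
    (hKA : krein_adler_condition D)
    (hN : (1 <= N)%N)
    (hND : N \notin D)
    (hdeg : size (krein_adler_poly c D N) = (ell' D + N).+1)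
    (hzeros : forall z : R[i],
       root (krein_adler_poly c D N) z <-> exists l, z = eta l)
    (hdistinct : injective eta)
    (hends : forall l, not_endpoint c (eta l)) :
  [/\ forall m n : nat,
        (m < N)%N -> m \notin D -> (n < N)%N -> n \notin D -> m != n ->
        \sum_l ((krein_adler_poly c D n).[eta l]
                  * (krein_adler_poly c D m).[eta l])
               / (eta_dot_sq c (eta l)
                  * ((krein_adler_poly c D N)^`()).[eta l] ^+ 2) = 0,
      forall (m : nat) (D' : seq nat),
        (m < N)%N -> m \notin D -> EP D N D' ->
        \sum_l ((krein_adler_poly c D m).[eta l]
                  * (krein_adler_poly c D' N).[eta l])
               / (eta_dot_sq c (eta l)
                  * ((krein_adler_poly c D N)^`()).[eta l] ^+ 2) = 0
    & forall D' D'' : seq nat,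
        EP D N D' -> EP D N D'' -> D' != D'' ->
        \sum_l ((krein_adler_poly c D' N).[eta l]
                  * (krein_adler_poly c D'' N).[eta l])
               / (eta_dot_sq c (eta l)
                  * ((krein_adler_poly c D N)^`()).[eta l] ^+ 2) = 0].
Proof.
have root_t l : root (krein_adler_poly c D N) (eta l) by apply/hzeros; exists l.
have orth i1 i2 e1 e2 := @krein_adler_orthogonality R c D N eta i1 i2 e1 e2
  hc hD hND hdeg root_t hdistinct hends.
have last_N : nth 0%N (rcons D N) (size D) = N by rewrite nth_rcons ltnn eqxx.
have nth_D j : (j < size D)%N -> nth 0%N (rcons D N) j = nth 0%N D j.
  by move=> jD; rewrite nth_rcons jD.
split.
(* Both numerators replace the last entry [N]; the replacing indices differ. *)
- move=> m n mN _ nN _ mn.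
  rewrite (krein_adler_replace_last c D N m) (krein_adler_replace_last c D N n).
  by apply: orth; rewrite ?last_N // xpair_eqE eqxx eq_sym.
(* Here the positions differ: one is last, the other lies inside [D]. *)
- move=> m D' mN _ [j [e [jD eD _ _ ->]]].
  have jD' : (j < (size D).+1)%N by rewrite ltnS ltnW.
  rewrite (krein_adler_replace_last c D N m) (krein_adler_replace c N e jD' jD).
  by apply: orth; rewrite ?last_N ?nth_D // xpair_eqE -val_eqE /= gtn_eqF.
move=> D' D'' [j1 [e1 [j1D e1D _ _ ->]]] [j2 [e2 [j2D e2D _ _ ->]]] ne.
have j1D' : (j1 < (size D).+1)%N by rewrite ltnS ltnW.
have j2D' : (j2 < (size D).+1)%N by rewrite ltnS ltnW.
rewrite (krein_adler_replace c N e1 j1D' j1D) (krein_adler_replace c N e2 j2D' j2D).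
apply: orth; rewrite ?nth_D //.
(* Equal positions and equal new entries would give equal lists. *)
by apply: contraNneq ne => -[-> ->].
Qed.
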